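(* Let $x_1,x_2,\ldots$ be independent and identically distributed with true density $f_0$. For $j=1,2$ let $M_j=\{f_j(x\mid\theta_j),\,\pi_j(\theta_j),\,\theta_j\in\mathbb{F}_j\}$ be a Bayesian model consisting of a parametric family of densities $f_j(\cdot\mid\theta_j)$ indexed by $\theta_j\in\mathbb{F}_j$ and a prior $\pi_j$ on $\mathbb{F}_j$, and define the Bayes factor $$B_{12}=\frac{\int_{\mathbb{F}_1}\prod_{i=1}^n f_1(x_i\mid\theta_1)\,\pi_1(d\theta_1)}{\int_{\mathbb{F}_2}\prod_{i=1}^n f_2(x_i\mid\theta_2)\,\pi_2(d\theta_2)}.$$ Suppose that: (i) $f_0$ is in the Kullback--Leibler support of $\pi_2$: for every $\epsilon>0$, $\pi_2[\theta_2: d_K\{f_0(\cdot),f_2(\cdot\mid\theta_2)\}<\epsilon]>0$; (ii) for every $c>0$, almost surely under $f_0$, for all sufficiently large $n$, $$\sup_{\theta_1\in\mathbb{F}_1}\prod_{i=1}^n\frac{f_1(x_i\mid\theta_1)}{f_0(x_i)}<e^{nc};$$ (iii) $\inf_{\theta_1\in\mathbb{F}_1} d_H\{f_1(\cdot\mid\theta_1),f_0(\cdot)\}>0$. Then $B_{12}\to 0$ almost surely under $f_0$ as $n\to\infty$.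
   Context: $d_K(f,g)=\int f\log(f/g)$ is the Kullback--Leibler divergence and $d_H(f,g)=\{\int(\sqrt f-\sqrt g)^2\}^{1/2}$ is the Hellinger distance. *)

(* Defs.v *)
From HB Require Import structures.
From mathcomp Require Import all_boot all_order all_algebra.
From mathcomp Require Import all_classical all_reals all_analysis.
Set Implicit Arguments. Unset Strict Implicit. Unset Printing Implicit Defensive.
Import Order.TTheory GRing.Theory Num.Theory.
Import numFieldNormedType.Exports.
Local Open Scope classical_set_scope.
Local Open Scope ring_scope.

Definition is_density {dT} {T : measurableType dT} {R : realType}
  (mu : {measure set T -> \bar R}) (f : T -> R) : Prop :=
  measurable_fun setT f /\ (forall x, 0 <= f x) /\
  (\int[mu]_x (f x)%:E = 1)%E.

(* Kullback--Leibler divergence d_K(f,g) = int f log(f/g), with the usual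
   conventions 0 log(0/g) = 0 and f log(f/0) = +oo when f > 0. *)
Definition KL_integrand {T} {R : realType} (f g : T -> R) (x : T) : \bar R :=
  if f x == 0 then 0%E
  else if g x == 0 then +oo%E
  else (f x * ln (f x / g x))%:E.

Definition dK {dT} {T : measurableType dT} {R : realType}
  (mu : {measure set T -> \bar R}) (f g : T -> R) : \bar R :=
  (\int[mu]_x KL_integrand f g x)%E.

(* Hellinger distance d_H(f,g) = ( int (sqrt f - sqrt g)^2 )^(1/2)
   (the integral is finite, at most 2, for densities) *)
Definition dH {dT} {T : measurableType dT} {R : realType}
  (mu : {measure set T -> \bar R}) (f g : T -> R) : R :=
  Num.sqrt (fine (\int[mu]_x ((Num.sqrt (f x) - Num.sqrt (g x)) ^+ 2)%:E)%E).

Definition mutually_independent {dO dT} {Omega : measurableType dO}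
  {T : measurableType dT} {R : realType} (P : probability Omega R)
  (X : nat -> Omega -> T) : Prop :=
  forall (s : seq nat) (A : nat -> set T),
    uniq s -> (forall i, measurable (A i)) ->
    P (\bigcap_(i in [set` s]) (X i @^-1` A i)) = (\prod_(i <- s) P (X i @^-1` A i))%E.

Definition iid_with_density {dO dT} {Omega : measurableType dO}
  {T : measurableType dT} {R : realType} (P : probability Omega R)
  (mu : {measure set T -> \bar R}) (X : nat -> Omega -> T) (f0 : T -> R) : Prop :=
  (forall i, measurable_fun setT (X i)) /\
  mutually_independent P X /\
  (forall i A, measurable A -> P (X i @^-1` A) = (\int[mu]_(x in A) (f0 x)%:E)%E).

Definition marginal_lik {dTh} {Omega : Type} {T : Type}
  {Th : measurableType dTh} {R : realType} (pi : probability Th R)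
  (f : Th -> T -> R) (X : nat -> Omega -> T) (n : nat) (w : Omega) : \bar R :=
  (\int[pi]_th (\prod_(i < n) f th (X i w))%:E)%E.

Definition bayes_factor {dTh1 dTh2} {Omega : Type} {T : Type}
  {Th1 : measurableType dTh1} {Th2 : measurableType dTh2} {R : realType}
  (pi1 : probability Th1 R) (f1 : Th1 -> T -> R)
  (pi2 : probability Th2 R) (f2 : Th2 -> T -> R)
  (X : nat -> Omega -> T) (n : nat) (w : Omega) : R :=
  fine (marginal_lik pi1 f1 X n w) / fine (marginal_lik pi2 f2 X n w).

(* Main.v *)
Require Import Defs.
From HB Require Import structures.
From mathcomp Require Import all_boot all_order all_algebra.
From mathcomp Require Import all_classical all_reals all_analysis.
From mathcomp Require Import measurable_realfun ring lra.
Import Order.TTheory GRing.Theory Num.Theory.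
Import numFieldNormedType.Exports.
Import HBNNSimple.
Local Open Scope classical_set_scope.
Local Open Scope ring_scope.

(** Divide numerator and denominator by the true likelihood [\prod_i f0 (x_i)].

    Numerator.  Writing the likelihood ratio as [L = sqrt L * sqrt L], (ii) bounds
    one factor by [exp (n c / 2)]; the prior mean of the other one has expectation
    at most [(1 - delta ^ 2 / 2) ^ n] by independence and (iii), so that it decays
    exponentially almost surely.

    Denominator.  If [d_K (f0, g) < eta (1 - exp (- eta))], then the positive part
    of [ln (f0 / g)] has mean at most [2 eta] under [f0].  The full strong law of
    large numbers is not needed: truncation along powers of two gives, for
    nonnegative summands of mean at most [m], that the sum of the first [n] is
    almost surely eventually at most [4 m n].  Hence the likelihood ratio of [g]
    is eventually at least [exp (- 8 eta n)].  By Fubini and (i) this holds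
    uniformly from some rank on over a set of parameters of positive prior mass,
    which bounds the denominator from below. *)

(** * Change of variables in the presence of a weight *)

Section weighted_transfer.
Context {R : realType}.

(** Monotone convergence along the simple approximations of [h]. The point of the formula is that
    [X] and [H] enter its right-hand side only through the integrals of [H] over events determined
    by [X]. *)
Lemma integral_comp_weight_lim {d dT : measure_display} {O : measurableType d}
    {T : measurableType dT} (P : {measure set O -> \bar R}) (X : O -> T)
    (H : O -> R) (h : T -> \bar R) (mh : measurable_fun setT h) :
  measurable_fun setT X -> measurable_fun setT H -> (forall w, 0 <= H w) ->
  (forall x, 0 <= h x)%E ->
  (\int[P]_w (h (X w) * (H w)%:E) =
   limn (fun n => \sum_(k \in range (nnsfun_approx measurableT mh n))
     (k%:E * \int[P]_(w in X @^-1` (nnsfun_approx measurableT mh n @^-1` [set k]))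
        (H w)%:E)))%E.
Proof.
move=> mX mH H0 h0.
pose f := nnsfun_approx measurableT mh.
have mpre n k : measurable (X @^-1` (f n @^-1` [set k])).
  by rewrite -[X in measurable X]setTI; apply: mX.
transitivity (limn (fun n => \int[P]_w ((f n (X w))%:E * (H w)%:E))%E).
  rewrite -monotone_convergence//; first last.
  - move=> w _ m n mn; rewrite lee_fin ler_wpM2r//.
    exact/lefP/nd_nnsfun_approx.
  - by move=> n w _; rewrite -EFinM lee_fin mulr_ge0.
  - move=> n; apply: emeasurable_funM; last exact/measurable_EFinP.
    by apply/measurable_EFinP; apply: measurableT_comp.
  apply: eq_integral => w _; apply/esym/cvg_lim => //.
  apply: cvgeZr => //.
  exact: cvg_nnsfun_approx.
congr (limn _); apply/funext => n.
under eq_integral.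
  move=> w _.
  rewrite fimfunE -fsumEFin// ge0_mule_fsuml; last first.
    by move=> r; exact: nnfun_muleindic_ge0.
  over.
rewrite ge0_integral_fsum//; first last.
- by move=> r w _; rewrite mule_ge0 ?lee_fin//; exact: nnfun_muleindic_ge0.
- move=> r; apply: emeasurable_funM; last exact/measurable_EFinP.
  apply/measurable_EFinP/measurable_funM => //.
  exact: (measurableT_comp (measurable_indic _)).
apply: eq_fsbigr => r /set_mem [x _ frx].
have r0 : 0 <= r by rewrite -frx.
rewrite [in RHS]integral_mkcond -ge0_integralZl//; first last.
- by move=> w _; rewrite patchE; case: ifP => // _; rewrite lee_fin.
- rewrite -(measurable_restrict _ _ _)//.
  by apply/measurable_EFinP; exact: measurable_funTS.
apply: eq_integral => w _; rewrite EFinM -muleA; congr (_ * _)%E.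
rewrite patchE indicE /preimage/=.
have -> : (X w \in [set t | f n t = r]) = (w \in [set t | f n (X t) = r]).
  by apply/idP/idP; rewrite !inE.
by case: ifP => _; rewrite ?mul1e ?mul0e.
Qed.

(** The limit formula only sees the integrals that are assumed to agree. Carrying a weight on both
    sides covers two uses at once: passing from [P] to a density, and replacing independent factors
    by their mean. *)
Lemma integral_comp_weight_eq {d1 d2 dT : measure_display}
    {O1 : measurableType d1} {O2 : measurableType d2} {T : measurableType dT}
    (P1 : {measure set O1 -> \bar R}) (P2 : {measure set O2 -> \bar R})
    (X1 : O1 -> T) (X2 : O2 -> T) (H1 : O1 -> R) (H2 : O2 -> R)
    (h : T -> \bar R) :
  measurable_fun setT X1 -> measurable_fun setT X2 ->
  measurable_fun setT H1 -> measurable_fun setT H2 ->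
  (forall w, 0 <= H1 w) -> (forall w, 0 <= H2 w) ->
  (forall A, measurable A -> \int[P1]_(w in X1 @^-1` A) (H1 w)%:E =
                             \int[P2]_(w in X2 @^-1` A) (H2 w)%:E)%E ->
  measurable_fun setT h -> (forall x, 0 <= h x)%E ->
  (\int[P1]_w (h (X1 w) * (H1 w)%:E) = \int[P2]_w (h (X2 w) * (H2 w)%:E))%E.
Proof.
move=> mX1 mX2 mH1 mH2 H10 H20 HA mh h0.
rewrite !(integral_comp_weight_lim _ _ _ _ mh)//; congr (limn _).
by apply/funext => n; apply: eq_fsbigr => k _; rewrite HA.
Qed.

End weighted_transfer.

(** * Expectations under the sampling law, and products of independent factors *)

Section iid_expectations.
Context {R : realType} {dO dT : measure_display} {O : measurableType dO}
  {T : measurableType dT} {P : probability O R}.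

(** Weighted transfer between [X i] with weight [1] and the identity of [T] with weight [f0]. *)
Lemma integral_comp_density {mu : {measure set T -> \bar R}} {X : nat -> O -> T}
    {f0 : T -> R} (i : nat) (h : T -> \bar R) :
  is_density mu f0 -> iid_with_density P mu X f0 ->
  measurable_fun setT h -> (forall x, 0 <= h x)%E ->
  (\int[P]_w h (X i w) = \int[mu]_x (h x * (f0 x)%:E))%E.
Proof.
move=> [mf0 [f00 _]] [mX [_ lawX]] mh h0.
transitivity (\int[P]_w (h (X i w) * (cst 1%R w)%:E))%E.
  by apply: eq_integral => w _; rewrite mule1.
apply: (integral_comp_weight_eq P mu (X i) id (cst 1%R) f0 h) => //.
move=> A mA; rewrite preimage_id -(lawX i)//.
have mXA : measurable (X i @^-1` A).
  by rewrite -[X in measurable X]setTI; apply: mX.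
by rewrite (integral_cst P mXA 1%:E) mul1e.
Qed.

Context {X : nat -> O -> T} (mX : forall i, measurable_fun setT (X i))
  (indep : mutually_independent P X).

(* The factors [g i (X i)] are introduced one at a time, the ones not yet
   treated being indicators. *)
Let prod_indic (g : nat -> T -> R) (s t : seq nat) (A : nat -> set T) :
  (forall i, measurable_fun setT (g i)) -> (forall i x, 0 <= g i x) ->
  (forall i, \int[P]_w (g i (X i w))%:E < +oo)%E ->
  uniq (s ++ t) -> (forall i, measurable (A i)) ->
  (\int[P]_w ((\prod_(i <- s) g i (X i w)) *
              \prod_(i <- t) \1_(A i) (X i w))%:E =
   (\prod_(i <- s) fine (\int[P]_w (g i (X i w))%:E) *
    \prod_(i <- t) fine (P (X i @^-1` A i)))%:E)%E.
Proof.
move=> mg g0 gfin; have mXA i B : measurable B -> measurable (X i @^-1` B).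
  by move=> mB; rewrite -[X in measurable X]setTI; apply: mX.
have Efin i : (\int[P]_w (g i (X i w))%:E)%E \is a fin_num.
  rewrite ge0_fin_numE//; apply: integral_ge0 => w _.
  by rewrite lee_fin.
elim: s t A => [|i s IH] t A us mA.
  rewrite big_nil mul1r.
  (* With indicators only, the product is the indicator of an intersection, and the claim is mutual
     independence itself. *)
  transitivity (\int[P]_w (\1_(\bigcap_(i in [set` t]) (X i @^-1` A i)) w)%:E)%E.
    apply: eq_integral => w _; rewrite big_nil mul1r; congr EFin.
    rewrite indicE; case: (boolP (_ \in _)) => [/set_mem wA|/negP wA].
      rewrite big_seq big1// => j jt; rewrite indicE mem_set//.
      exact: wA.
    suff /hasP[j jt XjA] : has (fun j => X j w \notin A j) t.
      rewrite (big_rem j jt)/= indicE (negbTE XjA) mul0r//.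
    apply/negPn/negP => /hasPn nt; apply: wA; rewrite inE => j /= jt.
    by apply/set_mem; move: (nt j jt); rewrite negbK.
  rewrite integral_indic//; last by apply: fin_bigcap_measurable => // *; exact: mXA.
  rewrite setIT; apply: (eq_trans (indep t A us mA)).
  rewrite -prodEFin; apply: eq_bigr => j _.
  by rewrite fineK// fin_num_measure//; exact: mXA.
move: us; rewrite cat_cons cons_uniq => /andP[ist us].
pose H w : R := (\prod_(i <- s) g i (X i w)) * \prod_(i <- t) \1_(A i) (X i w).
have mH : measurable_fun setT H.
  apply: measurable_funM; apply: measurable_prod => j _.
    exact: measurableT_comp.
  exact: (measurableT_comp (measurable_indic _)).
have H0 w : 0 <= H w by rewrite mulr_ge0//; apply: prodr_ge0.
have EH := IH t A us mA.
set e := (X in _ = X%:E) in EH.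
have e0 : 0 <= e.
  by rewrite -lee_fin -EH; apply: integral_ge0 => w _; rewrite lee_fin H0.
transitivity (\int[P]_w ((g i (X i w))%:E * (H w)%:E))%E.
  by apply: eq_integral => w _; rewrite big_cons -EFinM -mulrA.
(* The weight [H] may be replaced by its mean [e]: both have the same integral over the event that
   [X i] lies in [B], by the induction hypothesis with [i] added to the indicators, its set being
   [B]. *)
rewrite (integral_comp_weight_eq P P (X i) (X i) H (cst e) (EFin \o g i))//.
- rewrite /= ge0_integralZr//=.
  + by rewrite big_cons -mulrA [RHS]EFinM fineK.
  + by apply/measurable_EFinP; exact: measurableT_comp.
  + by move=> w _; rewrite lee_fin.
- move=> B mB.
  pose A' j := if j == i then B else A j.
  have mA' j : measurable (A' j) by rewrite /A'; case: ifP.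
  have A'i : A' i = B by rewrite /A' eqxx.
  have A't j : j \in t -> A' j = A j.
    rewrite /A'; case: eqP => // -> it.
    by move: ist; rewrite mem_cat it orbT.
  have /(IH (i :: t)) /(_ mA') IHi : uniq (s ++ i :: t).
    by rewrite -[i :: t]cat1s uniq_catCA /= ist us.
  rewrite (integral_cst P (mXA i _ mB) e%:E) integral_mkcond.
  move: IHi; rewrite big_cons.
  have -> : \prod_(j <- t) fine (P (X j @^-1` A' j)) =
            \prod_(j <- t) fine (P (X j @^-1` A j)).
    by apply: eq_big_seq => j jt; rewrite A't.
  rewrite A'i mulrCA -/e EFinM fineK ?fin_num_measure//; last exact: mXA.
  rewrite muleC => <-; apply: eq_integral => w _.
  have tA : \prod_(j <- t) (\1_(A' j) (X j w) : R) = \prod_(j <- t) \1_(A j) (X j w).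
    by apply: eq_big_seq => j jt; rewrite A't.
  rewrite big_cons A'i tA patchE mulrCA -/(H w) indicE.
  rewrite (_ : (w \in X i @^-1` B) = (X i w \in B)); last first.
    by apply/idP/idP; rewrite !inE.
  by case: ifP; rewrite ?mul1r ?mul0r.
- exact/measurable_EFinP.
- by move=> x; rewrite lee_fin.
Qed.

Lemma integral_prod_indep (g : nat -> T -> R) (s : seq nat) :
  (forall i, measurable_fun setT (g i)) -> (forall i x, 0 <= g i x) ->
  (forall i, \int[P]_w (g i (X i w))%:E < +oo)%E -> uniq s ->
  (\int[P]_w (\prod_(i <- s) g i (X i w))%:E =
   (\prod_(i <- s) fine (\int[P]_w (g i (X i w))%:E))%:E)%E.
Proof.
move=> mg g0 gfin us.
have := prod_indic g s [::] (fun=> setT) mg g0 gfin.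
rewrite cats0 big_nil mulr1 => <- //; apply: eq_integral => w _.
by rewrite big_nil mulr1.
Qed.

End iid_expectations.

(** * Borel--Cantelli and the variance of a sum *)

Section weak_type_law_of_large_numbers.
Context {R : realType} {dO dT : measure_display} {O : measurableType dO}
  {T : measurableType dT} {P : probability O R}.

(** Markov's inequality at level [1] makes the probabilities of the events [F k] summable;
    Borel--Cantelli concludes. Both almost sure bounds of the development, for the numerator and for
    the denominator, rest on it. *)
Lemma ae_lt1_of_summable_integral (V : nat -> O -> \bar R) :
  (forall k, measurable_fun setT (V k)) -> (forall k w, 0 <= V k w)%E ->
  (\sum_(k <oo) \int[P]_w V k w < +oo)%E ->
  {ae P, forall w, exists N : nat, forall k, (N <= k)%N -> (V k w < 1)%E}.
Proof.
move=> mV V0 sumV.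
pose F k := [set w | (1 <= V k w)%E].
have mF k : measurable (F k).
  by rewrite -[F k]setTI; exact: emeasurable_fun_c_infty.
have PF k : (P (F k) <= \int[P]_w V k w)%E.
  rewrite -[F k]setIT -integral_indic//; apply: ge0_le_integral => //.
  - exact/measurable_EFinP.
  - move=> w _; rewrite indicE.
    by case: (boolP (w \in F k)) => [/set_mem|_].
exists (lim_sup_set F); split.
- apply: bigcap_measurable => // n _; exact: bigcup_measurable.
- apply: lim_sup_set_cvg0 => //; apply: le_lt_trans sumV.
  by apply: lee_nneseries => k *; [exact: measure_ge0|exact: PF].
- move=> w /= nV n _; apply: contrapT => nF; apply: nV; exists n => k nk.
  rewrite ltNge; apply/negP => Vk; apply: nF; exists k => //.
Qed.

Context {mu : {measure set T -> \bar R}} {X : nat -> O -> T} {f0 : T -> R}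
  (df0 : is_density mu f0) (iid : iid_with_density P mu X f0).

Let mX i : measurable_fun setT (X i). Proof. by case: iid. Qed.

Lemma integral_comp_identical (i : nat) (h : T -> \bar R) :
  measurable_fun setT h -> (forall x, 0 <= h x)%E ->
  (\int[P]_w h (X i w) = \int[P]_w h (X 0%N w))%E.
Proof. by move=> mh h0; rewrite !(integral_comp_density _ _ df0 iid). Qed.

Lemma variance_sum_le (t : T -> R) (n : nat) (m : R) :
  measurable_fun setT t -> (forall x, 0 <= t x) ->
  (\int[P]_w (t (X 0%N w))%:E = m%:E)%E ->
  (\int[P]_w ((t (X 0%N w)) ^+ 2)%:E < +oo)%E ->
  (\int[P]_w (((\sum_(i < n) t (X i w)) - n%:R * m) ^+ 2)%:E <=
   n%:R%:E * \int[P]_w ((t (X 0%N w)) ^+ 2)%:E)%E.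
Proof.
move=> mt t0 m1 t2fin.
have mtX i : measurable_fun setT (fun w => t (X i w)) by exact: measurableT_comp.
set s2E := (\int[P]_w ((t (X 0%N w)) ^+ 2)%:E)%E in t2fin *.
have s2E0 : (0 <= s2E)%E by apply: integral_ge0 => w _; rewrite lee_fin sqr_ge0.
pose s2 := fine s2E.
have s2K : s2E = s2%:E by rewrite fineK// ge0_fin_numE.
have s20 : 0 <= s2 by rewrite fine_ge0.
have m0 : 0 <= m.
  by rewrite -lee_fin -m1; apply: integral_ge0 => w _; rewrite lee_fin.
have E1 i : (\int[P]_w (t (X i w))%:E)%E = m%:E.
  rewrite -m1; apply: (integral_comp_identical i (EFin \o t)) => //.
    exact/measurable_EFinP.
have E2 i : (\int[P]_w ((t (X i w)) ^+ 2)%:E)%E = s2%:E.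
  rewrite -s2K; apply: (integral_comp_identical i (fun x => ((t x) ^+ 2)%:E)).
    by apply/measurable_EFinP; exact: measurable_funX.
  by move=> x; rewrite lee_fin sqr_ge0.
(* Off the diagonal this is independence. The spare [m ^+ 2] on the diagonal gives one formula for
   all pairs, with double sum [n * s2 + n ^ 2 * m ^ 2]. *)
have E12 i j : (\int[P]_w (t (X i w) * t (X j w))%:E <=
    ((i == j)%:R * s2 + m ^+ 2)%:E)%E.
  have [->|ij] := eqVneq i j.
    under eq_integral do rewrite -expr2.
    by rewrite E2 mul1r lee_fin lerDl sqr_ge0.
  have us : uniq [:: i; j] by rewrite /= inE ij.
  have := integral_prod_indep mX (iid.2.1) (fun=> t) [:: i; j].
  move=> /(_ (fun=> mt) (fun=> t0)) H.
  rewrite (eq_integral (fun w => (\prod_(k <- [:: i; j]) t (X k w))%:E)); last first.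
    by move=> w _; rewrite big_cons big_seq1.
  rewrite H//; last by move=> k; rewrite E1 ltry.
  by rewrite big_cons big_seq1 !E1/= mul0r add0r expr2.
pose S w := \sum_(i < n) t (X i w).
have mS : measurable_fun setT S by exact: measurable_sum.
have S0 w : 0 <= S w by exact: sumr_ge0.
have ES : (\int[P]_w (S w)%:E)%E = (n%:R * m)%:E.
  under eq_integral do rewrite -sumEFin.
  rewrite ge0_integral_sum//; last 2 first.
  - by move=> i; exact/measurable_EFinP.
  - by move=> i w _; rewrite lee_fin.
  under eq_bigr do rewrite E1.
  by rewrite sumEFin sumr_const card_ord mulr_natl.
have ES2 : (\int[P]_w (S w ^+ 2)%:E <= (n%:R * s2 + n%:R ^+ 2 * m ^+ 2)%:E)%E.
  under eq_integral.
    move=> w _; rewrite expr2 /S big_distrlr/= -sumEFin.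
    under eq_bigr do rewrite -sumEFin.
    over.
  have mtt i j : measurable_fun setT (fun w => (t (X i w) * t (X j w))%:E).
    by apply/measurable_EFinP; exact: measurable_funM.
  have tt0 i j w : (0 <= (t (X i w) * t (X j w))%:E)%E.
    by rewrite lee_fin mulr_ge0.
  rewrite ge0_integral_sum//; last 2 first.
  - by move=> i; exact: emeasurable_sum.
  - by move=> i w _; exact: sume_ge0.
  under eq_bigr do rewrite ge0_integral_sum//.
  apply: (@le_trans _ _ (\sum_(i < n) \sum_(j < n) ((i == j)%:R * s2 + m ^+ 2)%:E)%E).
    by apply: lee_sum => i _; apply: lee_sum => j _; exact: E12.
  under eq_bigr do rewrite sumEFin.
  rewrite sumEFin lee_fin.
  under eq_bigr => i _.
    rewrite big_split/= sumr_const card_ord (bigD1 i)//= eqxx mul1r big1; last first.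
      by move=> j ji; rewrite eq_sym (negbTE ji) mul0r.
    over.
  rewrite sumr_const card_ord addr0 -[X in X <= _]mulr_natl -[m ^+ 2 *+ n]mulr_natl.
  by rewrite mulrDr mulrA expr2.
set V := (\int[P]_w ((S w - n%:R * m) ^+ 2)%:E)%E.
(* The expanded square, with its cross term moved to the left so that every integrand is nonnegative
   and additivity needs no integrability. *)
have key : (V + (2 * (n%:R * m) * (n%:R * m))%:E =
            \int[P]_w (S w ^+ 2)%:E + ((n%:R * m) ^+ 2)%:E)%E.
  have c0 : 0 <= 2 * (n%:R * m) by rewrite !mulr_ge0.
  rewrite EFinM -ES -ge0_integralZl//; last 2 first.
  - exact/measurable_EFinP.
  - by move=> w _; rewrite lee_fin.
  have <- : (\int[P]_w ((n%:R * m) ^+ 2)%:E = ((n%:R * m) ^+ 2)%:E)%E.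
    rewrite (integral_cst P measurableT ((n%:R * m) ^+ 2)%:E) -[RHS]mule1.
    by congr (_ * _)%E; exact: probability_setT.
  rewrite -!ge0_integralD//.
  - by apply: eq_integral => w _; rewrite -EFinM -!EFinD; congr EFin; ring.
  - by move=> w _; rewrite lee_fin sqr_ge0.
  - by apply/measurable_EFinP; exact: measurable_funX.
  - by move=> w _; rewrite lee_fin sqr_ge0.
  - by move=> w _; rewrite lee_fin sqr_ge0.
  - by apply/measurable_EFinP/measurable_funX/measurable_funB.
  - by move=> w _; rewrite mule_ge0 ?lee_fin.
  - by apply/measurable_EFinP; apply: measurable_funM.
rewrite s2K -EFinM -(leeD2rE (x := (2 * (n%:R * m) * (n%:R * m))%:E))//.
rewrite key -EFinD; apply: (le_trans (leeD2r _ ES2)).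
by rewrite -EFinD lee_fin exprMn le_eqVlt; apply/orP; left; apply/eqP; ring.
Qed.

End weak_type_law_of_large_numbers.

(** * A linear almost sure bound on sums of nonnegative variables *)

Section weak_type_lln.
Context {R : realType}.

(** The cost of a value [y] at scale [2 ^ k]: its share of the normalised second moment if it
    survives truncation at [2 ^ k], and its share of the count of truncated terms otherwise. *)
Let u (k : nat) (y : R) : R := if y <= 2 ^+ k then y ^+ 2 / 2 ^+ k else 2 ^+ k.

Let u_ge0 k y : 0 <= u k y.
Proof.
by rewrite /u; case: ifP => _; rewrite ?exprn_ge0// divr_ge0 ?sqr_ge0 ?exprn_ge0.
Qed.

(** Two geometric series meet at the scale of [y], each contributing at most [2 * y]. The induction
    adds to the partial sum the whole remaining tail [2 * (y ^ 2 / 2 ^ K)] once [2 ^ K] has reached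
    [y]. *)
Let sum_u_le (K : nat) (y : R) : 0 <= y -> \sum_(k < K) u k y <= 4 * y.
Proof.
move=> y0.
suff : if y <= 2 ^+ K then \sum_(k < K) u k y + 2 * (y ^+ 2 / 2 ^+ K) <= 4 * y
       else \sum_(k < K) u k y <= 2 ^+ K.
  case: ifPn => [_|]; last by rewrite -ltNge; lra.
  have : 0 <= y ^+ 2 / 2 ^+ K by rewrite divr_ge0 ?sqr_ge0 ?exprn_ge0.
  lra.
elim: K => [|K IH].
  by rewrite big_ord0 expr0; case: ifPn => [y1|_]; [nra|exact: ler01].
have p0 : 0 < 2 ^+ K :> R by rewrite exprn_gt0.
rewrite big_ord_recr/= {2 4}/u exprS; move: IH.
set p := (2 ^+ K : R) in p0 *.
have -> : y ^+ 2 / (2 * p) = y ^+ 2 / p / 2 by field; rewrite gt_eqF.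
case: (leP y p) => yp; first by rewrite ifT; lra.
case: ifP => y2p; last by lra.
move=> IH; suff : y ^+ 2 / p <= 2 * y by lra.
by rewrite ler_pdivrMr//; nra.
Qed.

Context {dO dT : measure_display} {O : measurableType dO}
  {T : measurableType dT} {P : probability O R}
  {mu : {measure set T -> \bar R}} {X : nat -> O -> T} {f0 : T -> R}
  (df0 : is_density mu f0) (iid : iid_with_density P mu X f0).

Let mX i : measurable_fun setT (X i). Proof. by case: iid. Qed.

(* Truncating [y (X i)] at [2 ^ k] for [i < 2 ^ k], both the number of truncated
   terms and the normalised squared deviation of the truncated sum have summable
   expectations over [k], as [\sum_k min (2 ^ k) (y ^ 2 / 2 ^ k) <= 4 y]. *)
Lemma ae_sum_le_dyadic (y : T -> R) (m : R) : 0 < m ->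
  measurable_fun setT y -> (forall x, 0 <= y x) ->
  (\int[P]_w (y (X 0%N w))%:E <= m%:E)%E ->
  {ae P, forall w, exists N : nat, forall k : nat, (N <= k)%N ->
    \sum_(i < 2 ^ k) y (X i w) <= 2 * m * (2 ^ k)%:R}.
Proof.
move=> m0 my y0 Ey.
have Ey0 : (0 <= \int[P]_w (y (X 0%N w))%:E)%E.
  by apply: integral_ge0 => w _; rewrite lee_fin.
pose n k := (2 ^ k)%N.
have nE k : (n k)%:R = 2 ^+ k :> R by rewrite natrX.
have n0 k : 0 < (n k)%:R :> R by rewrite nE exprn_gt0.
pose L k := [set x | y x <= 2 ^+ k].
have mL k : measurable (L k).
  have -> : L k = setT `&` y @^-1` [set` `]-oo, (2 ^+ k)]].
    by rewrite setTI; apply/seteqP; split=> x /=; rewrite in_itv/=.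
  exact: my.
pose t k x := y x * \1_(L k) x.
pose b k x : R := \1_(~` L k) x.
have mt k : measurable_fun setT (t k) by exact: measurable_funM.
have mb k : measurable_fun setT (b k) by apply: measurable_indic; exact: measurableC.
have t0 k x : 0 <= t k x by rewrite mulr_ge0.
have b0 k x : 0 <= b k x by [].
have mXc i (g : T -> R) : measurable_fun setT g ->
  measurable_fun setT (fun w => g (X i w)).
  by move=> mg; exact: measurableT_comp.
have ubt k x : u k (y x) = 2 ^+ k * b k x + t k x ^+ 2 / 2 ^+ k.
  rewrite /u /b /t !indicE in_setC.
  case: ifPn => yk.
    have -> : x \in L k by rewrite inE.
    by rewrite mulr0 add0r mulr1.
  have /negbTE -> : x \notin L k by rewrite notin_setE; exact/negP.
  by rewrite mulr0 expr0n/= mul0r addr0 mulr1.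
pose m_ k := fine (\int[P]_w (t k (X 0%N w))%:E)%E.
have Etle k : (\int[P]_w (t k (X 0%N w))%:E <= m%:E)%E.
  apply: le_trans Ey; apply: ge0_le_integral => //.
  - by move=> w _; rewrite lee_fin.
  - by apply/measurable_EFinP; exact: mXc.
  - by apply/measurable_EFinP; exact: mXc.
  - by move=> w _; rewrite lee_fin ler_piMr// indicE.
have Et k : (\int[P]_w (t k (X 0%N w))%:E)%E = (m_ k)%:E.
  rewrite fineK// ge0_fin_numE; first exact: (le_lt_trans (Etle k) (ltry _)).
  by apply: integral_ge0 => w _; rewrite lee_fin.
have m_le k : m_ k <= m by rewrite -lee_fin -Et.
(* Built so that [V k w < 1] says two things: no term among the first [n k] is truncated, and the
   truncated sum is within [n k * m] of its mean. *)
pose V k w := \sum_(i < n k) b k (X i w) +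
  (\sum_(i < n k) t k (X i w) - (n k)%:R * m_ k) ^+ 2 / ((n k)%:R * m) ^+ 2.
have V0 k w : 0 <= V k w.
  by rewrite addr_ge0 ?sumr_ge0// divr_ge0 ?sqr_ge0.
have mSt k : measurable_fun setT (fun w => \sum_(i < n k) t k (X i w)).
  by apply: measurable_sum => i; exact: mXc.
have mSb k : measurable_fun setT (fun w => \sum_(i < n k) b k (X i w)).
  by apply: measurable_sum => i; exact: mXc.
have mD k : measurable_fun setT
    (fun w => (\sum_(i < n k) t k (X i w) - (n k)%:R * m_ k) ^+ 2).
  by apply: measurable_funX; exact: measurable_funB.
have mV k : measurable_fun setT (V k).
  by apply: measurable_funD => //; exact: measurable_funM.
have mu_ k : measurable_fun setT (fun w => u k (y (X 0%N w))).
  rewrite (_ : (fun w => _) = fun w =>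
     2 ^+ k * b k (X 0%N w) + t k (X 0%N w) ^+ 2 / 2 ^+ k); last first.
    by apply/funext => w; rewrite ubt.
  apply: measurable_funD; apply: measurable_funM => //; first exact: mXc.
  by apply: measurable_funX; exact: mXc.
(* The count costs a factor [1]; the variance bound divided by [(n k * m) ^ 2] costs a factor
   [1 / m ^ 2]. *)
pose C := 1 + (m ^+ 2)^-1.
have C0 : 0 <= C by rewrite addr_ge0// invr_ge0 sqr_ge0.
have EV k : (\int[P]_w (V k w)%:E <= C%:E * \int[P]_w (u k (y (X 0%N w)))%:E)%E.
  rewrite (_ : (\int[P]_w (V k w)%:E)%E =
    ((n k)%:R%:E * \int[P]_w (b k (X 0%N w))%:E +
     ((((n k)%:R * m) ^+ 2)^-1)%:E *
     \int[P]_w ((\sum_(i < n k) t k (X i w) - (n k)%:R * m_ k) ^+ 2)%:E)%E);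
     last first.
    set c := ((n k)%:R * m) ^- 2.
    have c0 : 0 <= c by rewrite invr_ge0 sqr_ge0.
    rewrite -(@ge0_integralZl _ _ _ P _ measurableT _ _ c%:E)//; last 2 first.
    - exact/measurable_EFinP.
    - by move=> w _; rewrite lee_fin sqr_ge0.
    have <- : (\int[P]_w (\sum_(i < n k) b k (X i w))%:E =
      (n k)%:R%:E * \int[P]_w (b k (X 0%N w))%:E)%E.
      under eq_integral do rewrite -sumEFin.
      rewrite ge0_integral_sum//; last 2 first.
      - by move=> i; apply/measurable_EFinP; exact: mXc.
      - by move=> i w _; rewrite lee_fin.
      under eq_bigr => i _.
        rewrite (integral_comp_identical df0 iid i (EFin \o b k)); last 2 first.
        - exact/measurable_EFinP.
        - by move=> x; rewrite lee_fin.
        over.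
      rewrite sumr_const card_ord mule_natl//.
    rewrite -ge0_integralD//.
    - by apply: eq_integral => w _; rewrite /V EFinD EFinM muleC.
    - by move=> w _; rewrite lee_fin sumr_ge0.
    - exact/measurable_EFinP.
    - by move=> w _; rewrite -EFinM lee_fin mulr_ge0 ?sqr_ge0.
    - by apply/measurable_EFinP; exact: measurable_funM.
  have t2fin : (\int[P]_w ((t k (X 0%N w)) ^+ 2)%:E < +oo)%E.
    apply: (@le_lt_trans _ _ ((2 ^+ k) ^+ 2)%:E); last exact: ltry.
    rewrite -[leRHS]mule1 -(@probability_setT _ _ _ P).
    rewrite -(integral_cst P measurableT).
    apply: ge0_le_integral => //.
    - by move=> w _; rewrite lee_fin sqr_ge0.
    - by apply/measurable_EFinP/measurable_funX; exact: mXc.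
    - move=> w _; rewrite lee_fin ler_sqr ?nnegrE ?exprn_ge0//.
      rewrite /t indicE; case: (boolP (X 0%N w \in L k)) => [/set_mem ?|_].
        by rewrite mulr1.
      by rewrite mulr0 exprn_ge0.
  have := variance_sum_le df0 iid (t k) (n k) (m_ k) (mt k) (t0 k) (Et k) t2fin.
  set I2 := (\int[P]_w (t k (X 0%N w) ^+ 2)%:E)%E => VS.
  have -> : (\int[P]_w (u k (y (X 0%N w)))%:E =
    (n k)%:R%:E * \int[P]_w (b k (X 0%N w))%:E + ((n k)%:R^-1)%:E * I2)%E.
    rewrite -!ge0_integralZl//; last 4 first.
    - by apply/measurable_EFinP/measurable_funX; exact: mXc.
    - by move=> w _; rewrite lee_fin sqr_ge0.
    - by apply/measurable_EFinP; exact: mXc.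
    - by move=> w _; rewrite lee_fin.
    rewrite -ge0_integralD//.
    - apply: eq_integral => w _; rewrite ubt -nE EFinD !EFinM.
      by congr (_ + _)%E; rewrite muleC.
    - by move=> w _; rewrite -EFinM lee_fin mulr_ge0.
    - by apply/measurable_EFinP/measurable_funM => //; exact: mXc.
    - by move=> w _; rewrite -EFinM lee_fin mulr_ge0 ?invr_ge0 ?sqr_ge0.
    - by apply/measurable_EFinP/measurable_funM => //; apply: measurable_funX; exact: mXc.
  have I20 : (0 <= I2)%E by apply: integral_ge0 => w _; rewrite lee_fin sqr_ge0.
  have Ib0 : (0 <= \int[P]_w (b k (X 0%N w))%:E)%E.
    by apply: integral_ge0 => w _; rewrite lee_fin.
  move: (\int[P]_w (b k (X 0%N w))%:E)%E Ib0 I2 I20 VS => Ib Ib0 I2 I20 VS.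
  rewrite [leRHS]ge0_muleDr ?mule_ge0 ?lee_fin ?invr_ge0//.
  apply: leeD.
    rewrite muleA -EFinM; apply: lee_wpmul2r => //.
    by rewrite lee_fin ler_peMl// lerDl invr_ge0 sqr_ge0.
  apply: (le_trans (lee_wpmul2l _ VS)); first by rewrite lee_fin invr_ge0 sqr_ge0.
  rewrite !muleA -!EFinM; apply: lee_wpmul2r => //; rewrite lee_fin.
  have -> : ((n k)%:R * m) ^- 2 * (n k)%:R = (m ^+ 2)^-1 * (n k)%:R^-1.
    by field; rewrite !gt_eqF.
  by rewrite ler_wpM2r ?invr_ge0// lerDr.
have sumV : (\sum_(k <oo) \int[P]_w (V k w)%:E < +oo)%E.
  apply: (@le_lt_trans _ _ (C * (4 * m))%:E); last exact: ltry.
  apply: lime_le.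
    by apply: is_cvg_nneseries => k _ _; apply: integral_ge0 => w _; rewrite lee_fin.
  apply: nearW => K; rewrite big_mkord.
  apply: (@le_trans _ _ (\sum_(k < K) (C%:E * \int[P]_w (u k (y (X 0%N w)))%:E))%E).
    by apply: lee_sum => k _; exact: EV.
  rewrite -ge0_sume_distrr; last first.
    by move=> k _; apply: integral_ge0 => w _; rewrite lee_fin.
  rewrite EFinM; apply: lee_wpmul2l; first by rewrite lee_fin.
  rewrite -ge0_integral_sum//; last 2 first.
  - by move=> k; exact/measurable_EFinP.
  - by move=> k w _; rewrite lee_fin.
  apply: (@le_trans _ _ (\int[P]_w (4%:E * (y (X 0%N w))%:E))%E).
    apply: ge0_le_integral => //.
    - by move=> w _; rewrite sume_ge0// => k _; rewrite lee_fin.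
    - by apply: emeasurable_sum => k; exact/measurable_EFinP.
    - by apply/measurable_EFinP/measurable_funM => //; exact: mXc.
    - by move=> w _; rewrite sumEFin -EFinM lee_fin; exact: sum_u_le.
  rewrite ge0_integralZl//.
  - by rewrite EFinM lee_wpmul2l// lee_fin.
  - by apply/measurable_EFinP; exact: mXc.
  - by move=> w _; rewrite lee_fin.
have mVE k : measurable_fun setT (EFin \o V k) by exact/measurable_EFinP.
have VE0 k w : (0 <= (EFin \o V k) w)%E by rewrite lee_fin.
have := ae_lt1_of_summable_integral _ mVE VE0 sumV.
apply: filterS => w [N HN].
exists N => k /HN; rewrite lte_fin => Vk1.
have Sb1 : \sum_(i < n k) b k (X i w) < 1.
  by apply: le_lt_trans Vk1; rewrite lerDl divr_ge0 ?sqr_ge0.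
(* A count below [1] is zero. *)
have ytE (i : 'I_(n k)) : y (X i w) = t k (X i w).
  rewrite /t indicE; have [_|/negP XL] := boolP (X i w \in L k); first by rewrite mulr1.
  exfalso; move: Sb1; rewrite ltNge => /negP; apply.
  rewrite (bigD1 i)//= {1}/b indicE in_setC.
  by move/negP/negbTE: XL => ->; rewrite lerDl sumr_ge0.
rewrite (eq_bigr _ (fun i _ => ytE i)).
have Q1 : (\sum_(i < n k) t k (X i w) - (n k)%:R * m_ k) ^+ 2 / ((n k)%:R * m) ^+ 2 < 1.
  by apply: le_lt_trans Vk1; rewrite lerDr sumr_ge0.
have nm0 : 0 < (n k)%:R * m by rewrite mulr_gt0.
rewrite ltr_pdivrMr ?exprn_gt0// mul1r in Q1.
have nmm : (n k)%:R * m_ k <= (n k)%:R * m by rewrite ler_pM2l.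
(* The truncated mean is at most [m], so a sum above [2 * m * n k] would deviate by more than
   [n k * m], against [Q1]. *)
rewrite -/(n k) leNgt; apply/negP => abs.
move: Q1; rewrite ltNge => /negP; apply.
rewrite ler_sqr ?nnegrE ?(ltW nm0)//; last by lra.
by lra.
Qed.

(** Choose [k] with [2 ^ (k - 1) <= n < 2 ^ k]. Partial sums of nonnegative terms increase, so the
    bound at [2 ^ k] applies, and [2 ^ k <= 2 * n] doubles the constant. *)
Lemma ae_sum_le (y : T -> R) (m : R) : 0 < m ->
  measurable_fun setT y -> (forall x, 0 <= y x) ->
  (\int[P]_w (y (X 0%N w))%:E <= m%:E)%E ->
  {ae P, forall w, exists N : nat, forall n : nat, (N <= n)%N ->
    \sum_(i < n) y (X i w) <= 4 * m * n%:R}.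
Proof.
move=> m0 my y0 Ey.
apply: filterS (ae_sum_le_dyadic y m m0 my y0 Ey) => w [N HN].
exists (2 ^ N)%N => n Nn.
have n0 : (0 < n)%N by apply: leq_trans Nn; rewrite expn_gt0.
pose k := (trunc_log 2 n).+1.
have /andP[kn nk] : (2 ^ trunc_log 2 n <= n < 2 ^ k)%N by exact: trunc_log_bounds.
have Nk : (N <= k)%N.
  by rewrite -(@leq_exp2l 2)//; apply: leq_trans Nn _; exact: ltnW.
have /HN := Nk; move/(le_trans _) => /(_ (\sum_(i < n) y (X i w))) H.
apply: (le_trans (H _)).
  rewrite -!(big_mkord xpredT (fun i => y (X i w))).
  rewrite (big_cat_nat _ (ltnW nk))//= lerDl sumr_ge0//.
have -> : 4 * m * n%:R = 2 * m * (2 * n)%:R by rewrite natrM; ring.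
rewrite ler_pM2l ?mulr_gt0// ler_nat expnS leq_mul2l kn orbT//.
Qed.

End weak_type_lln.

(** * The Kullback--Leibler integrand and the positive part of the log-ratio *)

Section kullback_leibler.
Context {R : realType}.

Lemma measurable_fun_div {d : measure_display} {U : measurableType d}
    (f g : U -> R) : (forall x, 0 <= g x) ->
  measurable_fun setT f -> measurable_fun setT g ->
  measurable_fun setT (fun x => f x / g x).
Proof.
move=> g0 mf mg; apply: measurable_funM => //.
(* The two functions agree where [g] vanishes as well, both being [0] there. *)
rewrite (_ : (fun x => (g x)^-1) = (fun x => g x `^ (-1))); last first.
  by apply/funext => x; rewrite powR_inv1.
exact: (measurableT_comp (@measurable_powR R (-1)) mg).
Qed.

Lemma measurable_KL_integrand {d : measure_display} {U : measurableType d}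
    (f g : U -> R) : (forall x, 0 <= g x) ->
  measurable_fun setT f -> measurable_fun setT g ->
  measurable_fun setT (KL_integrand f g).
Proof.
move=> g0 mf mg; apply: measurable_fun_ifT => //.
  by apply: measurable_fun_eqr.
apply: measurable_fun_ifT => //.
  by apply: measurable_fun_eqr.
apply/measurable_EFinP; apply: measurable_funM => //.
exact: (measurableT_comp (@measurable_ln R) (measurable_fun_div _ _ g0 mf mg)).
Qed.

(* From [exp (- z) >= exp (- eta) * (1 + eta - z)], the tangent line at [eta]. *)
Lemma expR_tangent_le (eta z : R) : 0 < eta ->
  (1 - expR (- eta)) * (z - eta) <= expR (- z) - 1 + z.
Proof.
move=> eta0.
have : expR (- eta) * (1 + (eta - z)) <= expR (- z).
  rewrite [in leRHS](_ : - z = - eta + (eta - z)); last by ring.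
  by rewrite expRD ler_pM2l ?expR_gt0// expR_ge1Dx.
have := expR_ge1Dx (- eta); have := expR_gt0 (- eta); nra.
Qed.

(** Reduces pointwise inequalities between [f], [g] and the integrand to inequalities between [z]
    and [expR (- z)]. *)
Lemma KL_integrandE {U : Type} (f g : U -> R) (x : U) : 0 < f x -> 0 < g x ->
  exists2 z : R, z = ln (f x / g x) &
    g x = f x * expR (- z) /\ KL_integrand f g x = (f x * z)%:E.
Proof.
move=> fx gx; exists (ln (f x / g x)) => //; split.
  rewrite expRN lnK ?posrE ?divr_gt0// invf_div mulrC -mulrA mulVf ?mulr1//.
  by rewrite gt_eqF.
by rewrite /KL_integrand !gt_eqF.
Qed.

(** Where both are positive this is [expR (- z) >= 1 - z] multiplied by [f x]; elsewhere the
    conventions give it. *)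
Lemma KL_integrand_ge {U : Type} (f g : U -> R) (x : U) :
  0 <= f x -> 0 <= g x -> ((f x - g x)%:E <= KL_integrand f g x)%E.
Proof.
rewrite le_eqVlt => /predU1P[fx|fx].
  by move=> gx; rewrite /KL_integrand -fx eqxx lee_fin sub0r oppr_le0.
rewrite le_eqVlt => /predU1P[gx|gx].
  by rewrite /KL_integrand gt_eqF// -gx eqxx leey.
have [z _ [gE ->]] := KL_integrandE _ _ _ fx gx.
rewrite lee_fin gE; have := expR_ge1Dx (- z); nra.
Qed.

Context {dT : measure_display} {T : measurableType dT}
  {mu : {measure set T -> \bar R}} (f g : T -> R)
  (df : is_density mu f) (dg : is_density mu g).

Let f0 x : 0 <= f x. Proof. by case: df => _ []. Qed.
Let g0 x : 0 <= g x. Proof. by case: dg => _ []. Qed.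
Let mf : measurable_fun setT f. Proof. by case: df. Qed.
Let mg : measurable_fun setT g. Proof. by case: dg. Qed.
Let mk : measurable_fun setT (KL_integrand f g).
Proof. exact: measurable_KL_integrand. Qed.

(** The negative part is at most [g], hence has integral at most [1]; a finite upper bound on the
    divergence then controls the positive part. *)
Lemma integrable_KL_integrand (e : R) :
  (dK mu f g < e%:E)%E -> mu.-integrable setT (KL_integrand f g).
Proof.
rewrite /dK integralE => ke.
have Ineg : (\int[mu]_x (KL_integrand f g)^\- x <= 1)%E.
  case: dg => _ [_ <-]; apply: ge0_le_integral => //.
  - exact: measurable_funeneg.
  - exact/measurable_EFinP.
  - move=> x _; rewrite funenegE ge_max lee_fin g0 andbT leeNl.
    apply: le_trans (KL_integrand_ge _ _ x (f0 x) (g0 x)).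
    by rewrite lee_fin lerBrDl subrr.
have Ineg0 : (0 <= \int[mu]_x (KL_integrand f g)^\- x)%E.
  by apply: integral_ge0 => x _; exact: funeneg_ge0.
apply/integrableP; split => //.
under eq_integral do rewrite -/((abse \o KL_integrand f g) _) fune_abse.
rewrite ge0_integralD//; first last.
- exact: measurable_funeneg.
- exact: measurable_funepos.
have Ifin : (\int[mu]_x (KL_integrand f g)^\- x)%E \is a fin_num.
  by rewrite ge0_fin_numE//; apply: (le_lt_trans Ineg); rewrite ltry.
rewrite lte_add_pinfty//; last by rewrite ltey_eq Ifin.
by move: ke; rewrite lteBlDr// => /lt_trans; apply; rewrite -(fineK Ifin) -EFinD ltry.
Qed.

(** Adding [g - f], of integral zero, turns the integrand into a nonnegative [G] equal to
    [f * (expR (- z) - 1 + z)] where both densities are positive. The tangent bound there gives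
    [f * max (0, z) <= eta * f + G / a], whose integral is at most [eta + eta]. *)
Lemma integral_pos_log_ratio_le (eta : R) : 0 < eta ->
  (dK mu f g < (eta * (1 - expR (- eta)))%:E)%E ->
  (\int[mu]_x ((Num.max 0 (ln (f x / g x)))%:E * (f x)%:E) <= (2 * eta)%:E)%E.
Proof.
move=> eta0; set a := 1 - expR (- eta) => dKe.
have a0 : 0 < a by rewrite subr_gt0 expR_lt1 oppr_lt0.
have ik := integrable_KL_integrand _ dKe.
pose G x := (KL_integrand f g x + (g x - f x)%:E)%E.
have G0 x : (0 <= G x)%E.
  have := KL_integrand_ge f g x (f0 x) (g0 x).
  rewrite /G -leeBlDr//; first by rewrite sub0e -EFinN opprB.
have iE (h : T -> R) : is_density mu h -> mu.-integrable setT (EFin \o h).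
  move=> [mh [h0 h1]]; apply/integrableP; split; first exact/measurable_EFinP.
  under eq_integral do rewrite /= ger0_norm//.
  by rewrite h1 ltry.
have igf : mu.-integrable setT (fun x => (g x - f x)%:E).
  by under eq_fun do rewrite EFinB; apply: integrableB => //; exact: iE.
have EG : (\int[mu]_x G x <= (eta * a)%:E)%E.
  rewrite integralD//.
  under [X in (_ + X)%E]eq_integral do rewrite EFinB.
  rewrite integralB//; [|exact: iE|exact: iE].
  case: df => _ [_ ->]; case: dg => _ [_ ->].
  by rewrite subee// adde0; exact: ltW.
have mG : measurable_fun setT G.
  by apply: emeasurable_funD => //; apply/measurable_EFinP; exact: measurable_funB.
apply: (@le_trans _ _ (\int[mu]_x (eta%:E * (f x)%:E + a^-1%:E * G x))%E).
  apply: ge0_le_integral => //.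
  - by move=> x _; rewrite mule_ge0 ?lee_fin// le_max lexx.
  - apply: emeasurable_funM; apply/measurable_EFinP => //.
    apply: measurable_maxr => //.
    exact: (measurableT_comp (@measurable_ln R) (measurable_fun_div _ _ g0 mf mg)).
  - apply: emeasurable_funD; apply: emeasurable_funM => //.
    exact/measurable_EFinP.
  move=> x _; have Gx := G0 x.
  move: (f0 x); rewrite le_eqVlt => /predU1P[fx|fx].
    by rewrite -fx !mule0 add0e mule_ge0// lee_fin invr_ge0 ltW.
  (* If [g x = 0 < f x] then [G x] is [+oo] and the bound is trivial. *)
  move: (g0 x); rewrite le_eqVlt => /predU1P[gx|gx].
    rewrite /G /KL_integrand gt_eqF// -gx eqxx addye// gt0_muley ?lte_fin ?invr_gt0//.
    by rewrite -EFinM addey// leey.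
  have [z zE [gE kE]] := KL_integrandE _ _ _ fx gx.
  rewrite /G kE -zE -!(EFinM, EFinD) lee_fin gE.
  have H := expR_tangent_le eta z eta0; rewrite -/a in H.
  have -> : f x * z + (f x * expR (- z) - f x) = f x * (expR (- z) - 1 + z) by ring.
  rewrite mulrCA [eta * _]mulrC -mulrDr mulrC ler_pM2l// ge_max.
  have h0 : 0 <= expR (- z) - 1 + z by have := expR_ge1Dx (- z); lra.
  apply/andP; split; first by rewrite (addr_ge0 (ltW eta0))// mulr_ge0// invr_ge0 ltW.
  by rewrite -lerBlDl mulrC ler_pdivlMr// mulrC.
rewrite ge0_integralD//; last 4 first.
- by move=> x _; rewrite mule_ge0 ?lee_fin ?(ltW eta0).
- by apply: emeasurable_funM => //; exact/measurable_EFinP.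
- by move=> x _; rewrite mule_ge0 ?lee_fin ?invr_ge0 ?(ltW a0).
- by apply: emeasurable_funM.
rewrite !ge0_integralZl//; last 4 first.
- by rewrite lee_fin invr_ge0 ltW.
- exact/measurable_EFinP.
- by move=> x _; rewrite lee_fin.
- by rewrite lee_fin ltW.
case: df => _ [_ ->]; rewrite mule1.
have -> : (2 * eta)%:E = (eta%:E + a^-1%:E * (eta * a)%:E)%E.
  by rewrite -EFinM -EFinD; congr EFin; field; rewrite gt_eqF.
by rewrite leeD2l// lee_wpmul2l// lee_fin invr_ge0 ltW.
Qed.

End kullback_leibler.

(** * Likelihood ratios along the sample, and measurability of Kullback--Leibler balls *)

Section iid_likelihood.
Context {R : realType} {dO dT : measure_display} {O : measurableType dO}
  {T : measurableType dT} {P : probability O R}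
  {mu : {measure set T -> \bar R}} {X : nat -> O -> T} {f0 : T -> R}
  (df0 : is_density mu f0) (iid : iid_with_density P mu X f0).

Let mX i : measurable_fun setT (X i). Proof. by case: iid. Qed.
Let f00 x : 0 <= f0 x. Proof. by case: df0 => _ []. Qed.
Let mf0 : measurable_fun setT f0. Proof. by case: df0. Qed.

Lemma ae_comp_gt0 (g : T -> R) : measurable_fun setT g -> (forall x, 0 <= g x) ->
  {ae mu, forall x, g x = 0 -> f0 x = 0} ->
  {ae P, forall w, forall i, 0 < g (X i w)}.
Proof.
move=> mg g0 aeg; apply: ae_foralln => i.
pose A := g @^-1` [set 0].
have mA : measurable A by rewrite -[A]setTI; exact: mg.
exists (X i @^-1` A); split.
- by rewrite -[X in measurable X]setTI; apply: mX.
- have [_ [_ lawX]] := iid; apply: (eq_trans (lawX i _ mA)).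
  rewrite (ae_eq_integral (cst 0%E))//.
  + exact: integral0.
  + by apply/measurable_EFinP; exact: measurable_funTS.
  + by apply: filterS aeg => x gf Ax; rewrite gf.
- move=> w /= gw; apply/eqP; apply: contra_notT gw => gw.
  by rewrite lt_def gw g0.
Qed.

(** The constant [8] is the [4] of [ae_sum_le] times the mean bound [2 * eta] for the positive part
    of the log-ratio. *)
Lemma ae_prod_ge (g : T -> R) (eta : R) : is_density mu g -> 0 < eta ->
  (dK mu f0 g < (eta * (1 - expR (- eta)))%:E)%E ->
  {ae P, forall w, exists N : nat, forall n, (N <= n)%N ->
    expR (- (8 * eta * n%:R)) * \prod_(i < n) f0 (X i w) <=
    \prod_(i < n) g (X i w)}.
Proof.
move=> dg eta0 dKe; have [mg [g0 _]] := dg.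
pose y x := Num.max 0 (ln (f0 x / g x)).
have my : measurable_fun setT y.
  apply: measurable_maxr => //.
  exact: (measurableT_comp (@measurable_ln R) (measurable_fun_div _ _ g0 mf0 mg)).
have y0 x : 0 <= y x by rewrite le_max lexx.
have Ey : (\int[P]_w (y (X 0%N w))%:E <= (2 * eta)%:E)%E.
  rewrite (integral_comp_density 0%N (EFin \o y) df0 iid); last 2 first.
  - exact/measurable_EFinP.
  - by move=> x; rewrite lee_fin.
  exact: (integral_pos_log_ratio_le f0 g df0 dg).
have f0pos : {ae P, forall w, forall i, 0 < f0 (X i w)}.
  by apply: ae_comp_gt0 => //; exact: aeW.
have gpos : {ae P, forall w, forall i, 0 < g (X i w)}.
  apply: ae_comp_gt0 => //.
  (* The integrand is [+oo] where [g = 0 < f0]; being integrable, it is finite almost everywhere. *)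
  apply: filterS (integrable_ae measurableT
    (integrable_KL_integrand f0 g df0 dg _ dKe)) => x /(_ I) + gx.
  by rewrite /KL_integrand gx eqxx; case: eqP.
have eta2 : 0 < 2 * eta by rewrite mulr_gt0.
have lln := ae_sum_le df0 iid y (2 * eta) eta2 my y0 Ey.
near=> w.
have f0w : forall i, 0 < f0 (X i w) by near: w.
have gw : forall i, 0 < g (X i w) by near: w.
have [N HN] : exists N : nat, forall n : nat, (N <= n)%N ->
    \sum_(i < n) y (X i w) <= 4 * (2 * eta) * n%:R by near: w.
exists N => n /HN Hn.
apply: (@le_trans _ _ (\prod_(i < n) (expR (- y (X i w)) * f0 (X i w)))).
  rewrite big_split/= -expR_sum ler_wpM2r ?prodr_ge0// ler_expR sumrN lerN2.
  by apply: (le_trans Hn); rewrite le_eqVlt; apply/orP; left; apply/eqP; ring.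
apply: ler_prod => i _; rewrite mulr_ge0 ?expR_ge0//=.
rewrite -ler_pdivlMr// -[leRHS]lnK ?posrE ?divr_gt0// ler_expR lerNl -lnV ?posrE ?divr_gt0//.
by rewrite invf_div le_max lexx orbT.
Unshelve. all: by end_near. Qed.

(** Tonelli's theorem asks for a sigma-finite measure, while [mu] is arbitrary; hence the detour
    through [P] for the positive and negative parts. *)
Lemma measurable_dK_lt {d : measure_display} {Th : measurableType d}
    (f : Th -> T -> R) (e : \bar R) : (forall th, is_density mu (f th)) ->
  measurable_fun setT (fun p : Th * T => f p.1 p.2) ->
  measurable [set th | (dK mu f0 (f th) < e)%E].
Proof.
move=> df mf.
have f_ge0 th x : 0 <= f th x by case: (df th) => _ [].
pose k := KL_integrand (fun p : Th * T => f0 p.2) (fun p => f p.1 p.2).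
have mk : measurable_fun setT k.
  by apply: measurable_KL_integrand => //; exact: measurableT_comp.
(* Dividing by [f0], which vanishes only where the integrand does, turns the
   integrals over [mu] into integrals over the probability [P]. *)
have mI (h : Th * T -> \bar R) : measurable_fun setT h ->
    (forall p, 0 <= h p)%E -> (forall p, f0 p.2 = 0 -> h p = 0%E) ->
    measurable_fun setT (fun th => \int[mu]_x h (th, x))%E.
  move=> mh h0 hf0.
  pose h' p := (h p * (1 / f0 p.2)%:E)%E.
  have mh' : measurable_fun setT h'.
    apply: emeasurable_funM => //; apply/measurable_EFinP.
    by apply: measurable_fun_div => //; exact: measurableT_comp.
  have h'0 p : (0 <= h' p)%E by rewrite mule_ge0// lee_fin divr_ge0.
  have -> : (fun th => \int[mu]_x h (th, x))%E =
            fubini_F P (fun q : Th * O => h' (q.1, X 0%N q.2)).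
    apply/funext => th; rewrite /fubini_F/=.
    rewrite (integral_comp_density 0%N (fun x => h' (th, x)) df0 iid)//; last first.
      by apply: measurableT_comp mh' _; exact: measurable_pair1.
    apply: eq_integral => x _; rewrite /h'/= -muleA -EFinM.
    have [fx|fx] := eqVneq (f0 x) 0; first by rewrite hf0 ?mul0e.
    by rewrite div1r mulVf// mule1.
  apply: measurable_fun_fubini_tonelli_F => //.
  apply: (measurableT_comp mh'); apply: measurable_fun_pair => //.
  exact: measurableT_comp.
have dKE : (fun th => dK mu f0 (f th)) =
    (fun th => \int[mu]_x k^\+ (th, x) - \int[mu]_x k^\- (th, x))%E.
  apply/funext => th; rewrite /dK integralE; congr (_ - _)%E;
    by apply: eq_integral => x _; rewrite ?funeposE ?funenegE.
have k0 p : f0 p.2 = 0 -> k p = 0%E by move=> fp; rewrite /k /KL_integrand fp eqxx.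
rewrite -[X in measurable X]setTI; apply: emeasurable_fun_infty_o => //.
rewrite dKE; apply: emeasurable_funB; apply: mI.
- exact: measurable_funepos.
- by [].
- by move=> p /k0 kp; rewrite funeposE kp maxxx.
- exact: measurable_funeneg.
- by [].
- by move=> p /k0 kp; rewrite funenegE kp oppe0 maxxx.
Qed.

End iid_likelihood.

(** * From pointwise bounds in the parameter to a bound on the marginal likelihood *)

Section marginal_likelihood.
Context {R : realType} {dO dT d : measure_display} {O : measurableType dO}
  {T : measurableType dT} {Th : measurableType d} {P : probability O R}
  {X : nat -> O -> T} (mX : forall i, measurable_fun setT (X i))
  (pi : probability Th R) (f : Th -> T -> R)
  (mf : measurable_fun setT (fun p : Th * T => f p.1 p.2))
  (f_ge0 : forall th x, 0 <= f th x).

(** The indicator of [B] has double integral zero in one order, hence in the other, and a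
    nonnegative function of zero integral vanishes almost everywhere. *)
Lemma ae_of_fubini_ae (B : set (Th * O)) : measurable B ->
  (forall th, {ae P, forall w, ~ B (th, w)}) ->
  {ae P, forall w, {ae pi, forall th, ~ B (th, w)}}.
Proof.
move=> mB aeB.
pose h (q : Th * O) : \bar R := (\1_B q)%:E.
have mh : measurable_fun setT h by exact/measurable_EFinP.
have h0 q : (0 <= h q)%E by rewrite lee_fin.
have hB q : h q = 0%E -> ~ B q.
  by move=> hq Bq; move: hq; rewrite /h indicE mem_set// => -[]/eqP; rewrite oner_eq0.
have E0 : (\int[pi]_th \int[P]_w h (th, w) = 0)%E.
  apply: integral0_eq => th _; rewrite (ae_eq_integral (cst 0%E))//.
  - exact: integral0.
  - exact: (measurableT_comp mh (measurable_pair1 _)).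
  - by apply: filterS (aeB th) => w nB _; rewrite /h indicE memNset.
rewrite (fubini_tonelli h)// in E0.
have := (ae_eq_integral_abs P measurableT
  (measurable_fun_fubini_tonelli_G h mh h0 (m1 := pi))).1.
rewrite /fubini_G; under eq_integral.
  move=> w _; rewrite gee0_abs; last by apply: integral_ge0 => th _; exact: h0.
  over.
move=> /(_ E0); apply: filterS => w /(_ I) Ew.
have mhw : measurable_fun setT (fun th => h (th, w)).
  exact: (measurableT_comp mh (measurable_pair2 _)).
have := (ae_eq_integral_abs pi measurableT mhw).1.
under eq_integral do rewrite gee0_abs//.
by move=> /(_ Ew); apply: filterS => th /(_ I)/hB.
Qed.

(** The rank [N] in the hypothesis depends on both [th] and [w]. For almost every [w], almost every
    [th] in [K] has some rank, so by countable subadditivity one rank serves a subset of positive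
    mass; that mass is [c]. *)
Lemma ae_marginal_lik_ge (l : nat -> O -> R) (K : set Th) :
  (forall n, measurable_fun setT (l n)) -> (forall n w, 0 <= l n w) ->
  measurable K -> (0 < pi K)%E ->
  (forall th, K th -> {ae P, forall w, exists N : nat, forall n, (N <= n)%N ->
      l n w <= \prod_(i < n) f th (X i w)}) ->
  {ae P, forall w, exists2 c : R, 0 < c & exists N : nat, forall n, (N <= n)%N ->
      ((c * l n w)%:E <= marginal_lik pi f X n w)%E}.
Proof.
move=> ml l0 mK K0 aeK.
have mprod n : measurable_fun setT
    (fun q : Th * O => \prod_(i < n) f q.1 (X i q.2)).
  apply: measurable_prod => i _.
  apply: (measurableT_comp mf (f := fun p : Th * T => f p.1 p.2)
    (g := fun q : Th * O => (q.1, X i q.2))).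
  by apply: measurable_fun_pair => //; exact: measurableT_comp.
pose G N := \bigcap_(n in [set n | (N <= n)%N])
  [set q : Th * O | l n q.2 <= \prod_(i < n) f q.1 (X i q.2)].
have mG N : measurable (G N).
  apply: bigcap_measurableType => n _.
  rewrite -[X in measurable X]setTI; apply: measurable_fun_le => //.
  exact: measurableT_comp.
(* The pairs with parameter in [K] for which no rank works. *)
pose B := (K `*` setT) `\` \bigcup_N G N.
have mB : measurable B.
  by apply: measurableD; [exact: measurableX|exact: bigcup_measurable].
have aeB th : {ae P, forall w, ~ B (th, w)}.
  have [Kth|nK] := pselect (K th); last by apply: aeW => w [[]].
  apply: filterS (aeK th Kth) => w [N HN] [_]; apply.
  by exists N => // n /= /HN.
apply: filterS (ae_of_fubini_ae _ mB aeB) => w nB.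
pose KN N := K `&` [set th | G N (th, w)].
have mKN N : measurable (KN N).
  apply: measurableI => //.
  rewrite -[X in measurable X]setTI.
  exact: (measurable_pair2 w measurableT (mG N)).
have [N piN] : exists N, (0 < pi (KN N))%E.
  apply: contrapT => /forallNP nN.
  have : pi.-negligible K.
    apply: (@negligibleS _ _ _ _ ([set th | B (th, w)] `|` \bigcup_N KN N)).
      move=> th Kth; have [[N _ GN]|nG] := pselect ((\bigcup_N G N) (th, w)).
        by right; exists N.
      by left.
    apply: negligibleU; first by apply: negligibleS nB => th /= Bth /(_ Bth).
    apply: negligible_bigcup => N; apply/negligibleP => //.
    apply/eqP; rewrite eq_le measure_ge0 andbT leNgt; apply/negP; exact: nN.
  move/negligibleP => /(_ mK) pK.
  by move: K0; rewrite pK ltxx.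
have piNfin : pi (KN N) \is a fin_num by exact: fin_num_measure.
exists (fine (pi (KN N))); first by rewrite fine_gt0// piN ltey_eq piNfin.
exists N => n Nn.
have mw : measurable_fun setT (fun th => (\prod_(i < n) f th (X i w))%:E).
  apply/measurable_EFinP.
  exact: (measurableT_comp (mprod n) (measurable_pair2 w)).
apply: (@le_trans _ _ (\int[pi]_(th in KN N) (\prod_(i < n) f th (X i w))%:E)%E).
  rewrite EFinM fineK// muleC -(integral_cst pi (mKN N)).
  apply: ge0_le_integral => //.
  - by move=> th _; rewrite lee_fin.
  - exact: measurable_funTS.
  - by move=> th [_ /(_ n Nn)]; rewrite lee_fin.
apply: ge0_subset_integral => // th _.
by rewrite lee_fin prodr_ge0.
Qed.

End marginal_likelihood.

(** * Hellinger distance and affinity *)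

Section hellinger.
Context {R : realType}.

Lemma measurable_fun_sqrt {d : measure_display} {U : measurableType d}
    (f : U -> R) :
  measurable_fun setT f -> measurable_fun setT (fun x => Num.sqrt (f x)).
Proof.
by apply: measurableT_comp; apply: continuous_measurable_fun; exact: sqrt_continuous.
Qed.

(** Expanding the square gives [D + 2 * A = 2] for the squared distance [D] and the affinity [A],
    written here as the mean under [f0] of the root of the ratio. *)
Lemma hellinger_affinity_le {dT : measure_display} {T : measurableType dT}
    {mu : {measure set T -> \bar R}} (f f0 : T -> R) (delta : R) :
  is_density mu f -> is_density mu f0 -> 0 < delta -> delta <= dH mu f f0 ->
  (\int[mu]_x ((Num.sqrt (f x / f0 x))%:E * (f0 x)%:E) <=
   (1 - delta ^+ 2 / 2)%:E)%E.
Proof.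
move=> [mf [f_ge0 f1]] [mf0 [f0_ge0 f01]] d0.
have msq := @measurable_fun_sqrt dT T.
have mD : measurable_fun setT (fun x => (Num.sqrt (f x) - Num.sqrt (f0 x)) ^+ 2).
  by apply: measurable_funX; apply: measurable_funB; exact: msq.
have mr : measurable_fun setT (fun x => Num.sqrt (f x / f0 x) * f0 x).
  by apply: measurable_funM => //; apply: msq; exact: measurable_fun_div.
rewrite /dH; set D := (\int[mu]_x _)%E => dD.
under eq_integral do rewrite -EFinM.
set A := (\int[mu]_x _)%E.
have D0 : (0 <= D)%E by apply: integral_ge0 => x _; rewrite lee_fin sqr_ge0.
have A0 : (0 <= A)%E by apply: integral_ge0 => x _; rewrite lee_fin mulr_ge0 ?sqrtr_ge0.
have DA : (D + 2%:E * A = 2%:E)%E.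
  rewrite -ge0_integralZl//; last 2 first.
  - exact/measurable_EFinP.
  - by move=> x _; rewrite lee_fin mulr_ge0 ?sqrtr_ge0.
  rewrite -ge0_integralD//; last 4 first.
  - by move=> x _; rewrite lee_fin sqr_ge0.
  - exact/measurable_EFinP.
  - by move=> x _; rewrite -EFinM lee_fin !mulr_ge0 ?sqrtr_ge0.
  - by apply/measurable_EFinP; exact: measurable_funM.
  transitivity (\int[mu]_x ((f x)%:E + (f0 x)%:E))%E; last first.
    rewrite ge0_integralD//; first by rewrite f1 f01.
    - by move=> x _; rewrite lee_fin.
    - exact/measurable_EFinP.
    - by move=> x _; rewrite lee_fin.
    - exact/measurable_EFinP.
  apply: eq_integral => x _; rewrite -EFinM -!EFinD; congr EFin.
  (* Where [f0] vanishes, the factor [f0 x] cancels whatever value the quotient takes. *)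
  have [fx|fx] := eqVneq (f0 x) 0.
    by rewrite fx sqrtr0 subr0 !mulr0 !addr0 sqr_sqrtr.
  have fx0 : 0 < f0 x by rewrite lt_def fx f0_ge0.
  have -> : Num.sqrt (f x / f0 x) * f0 x = Num.sqrt (f x) * Num.sqrt (f0 x).
    rewrite -{2}(sqr_sqrtr (ltW fx0)) expr2 mulrA -sqrtrM ?divr_ge0//.
    by rewrite divfK.
  rewrite sqrrB !sqr_sqrtr//; ring.
(* [dH] is defined through [fine], which sends [+oo] to [0]; finiteness makes it the genuine
   distance. *)
have Dfin : D \is a fin_num.
  rewrite ge0_fin_numE//; apply: (@le_lt_trans _ _ 2%:E); last exact: ltry.
  by rewrite -DA leeDl// mule_ge0.
have Afin : A \is a fin_num.
  rewrite ge0_fin_numE// ltNge; apply/negP; rewrite leye_eq => /eqP Ay.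
  by move: DA; rewrite Ay gt0_muley ?lte_fin// addey// gt_eqF// (lt_le_trans _ D0).
move: DA; rewrite -(fineK Dfin) -(fineK Afin) -EFinM -EFinD => -[DA].
have : delta ^+ 2 <= fine D.
  rewrite -[leRHS]sqr_sqrtr ?fine_ge0// ler_sqr ?nnegrE ?sqrtr_ge0// ltW//.
by rewrite lee_fin; lra.
Qed.

End hellinger.

(** * Exponential decay of the prior mean of the root likelihood ratio *)

Section bayes_factor_numerator.
Context {R : realType} {dO dT d : measure_display} {O : measurableType dO}
  {T : measurableType dT} {Th : measurableType d} {P : probability O R}
  {mu : {measure set T -> \bar R}} {X : nat -> O -> T} {f0 : T -> R}
  (df0 : is_density mu f0) (iid : iid_with_density P mu X f0)
  (pi : probability Th R) (f : Th -> T -> R)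
  (df : forall th, is_density mu (f th))
  (mf : measurable_fun setT (fun p : Th * T => f p.1 p.2)).

Let mX i : measurable_fun setT (X i). Proof. by case: iid. Qed.
Let f0_ge0 x : 0 <= f0 x. Proof. by case: df0 => _ []. Qed.
Let mf0 : measurable_fun setT f0. Proof. by case: df0. Qed.

(** Each factor has mean at most [1 - delta ^ 2 / 2 <= expR (- (2 * b))], so by Tonelli and
    independence the prior mean has expectation at most [expR (- (2 * b * n))]. Half of this rate is
    kept for summability, the other half is the rate obtained. *)
Lemma ae_root_lik_lt (b delta : R) : 0 < delta -> b = delta ^+ 2 / 4 ->
  (forall th, delta <= dH mu (f th) f0) ->
  {ae P, forall w, exists N : nat, forall n, (N <= n)%N ->
    ((expR (n%:R * b))%:E *
      \int[pi]_th (\prod_(i < n) Num.sqrt (f th (X i w) / f0 (X i w)))%:E < 1)%E}.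
Proof.
move=> d0 bE dH_ge.
have b0 : 0 < b by rewrite bE divr_gt0// exprn_gt0.
pose s (p : Th * T) := Num.sqrt (f p.1 p.2 / f0 p.2).
have ms : measurable_fun setT s.
  by apply: measurable_fun_sqrt; apply: measurable_fun_div => //; exact: measurableT_comp.
have s0 p : 0 <= s p by exact: sqrtr_ge0.
pose L n (q : Th * O) : \bar R := (\prod_(i < n) s (q.1, X i q.2))%:E.
have mL n : measurable_fun setT (L n).
  apply/measurable_EFinP; apply: measurable_prod => i _.
  apply: (measurableT_comp ms (g := fun q : Th * O => (q.1, X i q.2))).
  by apply: measurable_fun_pair => //; exact: measurableT_comp.
have L0 n q : (0 <= L n q)%E by rewrite lee_fin prodr_ge0.
pose J n w := (\int[pi]_th L n (th, w))%E.
have mJ n : measurable_fun setT (J n).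
  exact: (measurable_fun_fubini_tonelli_G (L n) (mL n) (L0 n) (m1 := pi)).
have J0 n w : (0 <= J n w)%E by apply: integral_ge0 => th _.
have msth th : measurable_fun setT (fun x => s (th, x)).
  exact: (measurableT_comp ms (measurable_pair1 th)).
have Es th i : (\int[P]_w (s (th, X i w))%:E <= (expR (- (2 * b)))%:E)%E.
  rewrite (integral_comp_density i (fun x => (s (th, x))%:E) df0 iid); last 2 first.
  - exact/measurable_EFinP.
  - by move=> x; rewrite lee_fin.
  apply: (le_trans (hellinger_affinity_le _ _ _ (df th) df0 d0 (dH_ge th))).
  by rewrite lee_fin; have := expR_ge1Dx (- (2 * b)); rewrite bE; lra.
have EJ n : (\int[P]_w J n w <= (expR (- (2 * b)) ^+ n)%:E)%E.
  rewrite -(fubini_tonelli (L n))//.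
  rewrite -[leRHS]mule1 -(@probability_setT _ _ _ pi) -(integral_cst pi measurableT).
  apply: ge0_le_integral => //.
  - by move=> th _; apply: integral_ge0 => w _; exact: L0.
  - exact: (measurable_fun_fubini_tonelli_F (L n) (mL n) (L0 n) (m2 := P)).
  move=> th _; rewrite /L /=.
  under eq_integral do rewrite -(big_mkord xpredT (fun i => s (th, X i _))).
  rewrite (integral_prod_indep mX iid.2.1 (fun=> fun x => s (th, x)))//; last 2 first.
  - by move=> i; apply: (le_lt_trans (Es th i)); rewrite ltry.
  - exact: iota_uniq.
  rewrite lee_fin big_mkord -[in leRHS](card_ord n) -prodr_const.
  apply: ler_prod => i _; rewrite fine_ge0/=; last first.
    by apply: integral_ge0 => w _; rewrite lee_fin.
  have Efin : (\int[P]_w (s (th, X i w))%:E)%E \is a fin_num.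
    rewrite ge0_fin_numE; first by apply: (le_lt_trans (Es th i)); rewrite ltry.
    by apply: integral_ge0 => w _; rewrite lee_fin.
  by rewrite -lee_fin fineK.
pose V n w := ((expR (n%:R * b))%:E * J n w)%E.
apply: (ae_lt1_of_summable_integral V).
- by move=> n; apply: emeasurable_funM.
- by move=> n w; rewrite mule_ge0// lee_fin expR_ge0.
have q0 : 0 < 1 - expR (- b) by rewrite subr_gt0 expR_lt1 oppr_lt0.
apply: (@le_lt_trans _ _ (1 - expR (- b))^-1%:E); last exact: ltry.
apply: lime_le.
  apply: is_cvg_nneseries => n _ _; apply: integral_ge0 => w _.
  by rewrite mule_ge0// lee_fin expR_ge0.
apply: nearW => m; rewrite big_mkord.
apply: (@le_trans _ _ (\sum_(n < m) (expR (- b) ^+ n)%:E)%E).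
  apply: lee_sum => n _; rewrite ge0_integralZl//.
  apply: (le_trans (lee_wpmul2l _ (EJ n))); first by rewrite lee_fin expR_ge0.
  rewrite -EFinM lee_fin -!expRM_natl -expRD ler_expR le_eqVlt.
  by apply/orP; left; apply/eqP; ring.
rewrite sumEFin lee_fin -[leRHS]mul1r ler_pdivlMr// mulrC.
rewrite -(opprB (expR _)) mulNr -subrX1 opprB gerBl exprn_ge0// expR_ge0//.
Qed.

End bayes_factor_numerator.

(** * Convergence of the Bayes factor *)

Theorem theorem1 (R : realType)
  (dO : measure_display) (Omega : measurableType dO) (P : probability Omega R)
  (dT : measure_display) (T : measurableType dT) (mu : {measure set T -> \bar R})
  (X : nat -> Omega -> T) (f0 : T -> R)
  (d1 : measure_display) (Th1 : measurableType d1) (pi1 : probability Th1 R)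
  (f1 : Th1 -> T -> R)
  (d2 : measure_display) (Th2 : measurableType d2) (pi2 : probability Th2 R)
  (f2 : Th2 -> T -> R) :
  is_density mu f0 ->
  iid_with_density P mu X f0 ->
  (forall th, is_density mu (f1 th)) ->
  (forall th, is_density mu (f2 th)) ->
  measurable_fun setT (fun p : Th1 * T => f1 p.1 p.2) ->
  measurable_fun setT (fun p : Th2 * T => f2 p.1 p.2) ->
  (* (i) f0 is in the Kullback--Leibler support of pi2 *)
  (forall eps : R, 0 < eps ->
     (0 < pi2 [set th | (dK mu f0 (f2 th) < eps%:E)%E])%E) ->
  (* (ii) *)
  (forall c : R, 0 < c ->
     {ae P, forall w, exists N : nat, forall n : nat, (N <= n)%N ->
        (ereal_sup [set (\prod_(i < n) (f1 th (X i w) / f0 (X i w)))%:E | th in setT]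
          < (expR (n%:R * c))%:E)%E}) ->
  (* (iii) *)
  (exists delta : R, 0 < delta /\ forall th, delta <= dH mu (f1 th) (f0)) ->
  {ae P, forall w, (fun n => bayes_factor pi1 f1 pi2 f2 X n w) @ \oo --> (0 : R)}.
Proof.
move=> df0 iid df1 df2 mf1 mf2 KLsupp supL [delta [d0 dH_ge]].
have [mf0 [f0_ge0 _]] := df0.
have mX i : measurable_fun setT (X i) by case: iid.
have f1_ge0 th x : 0 <= f1 th x by case: (df1 th) => _ [].
have f2_ge0 th x : 0 <= f2 th x by case: (df2 th) => _ [].
pose b := delta ^+ 2 / 4.
have b0 : 0 < b by rewrite divr_gt0// exprn_gt0.
(* Makes the loss [8 * eta] in the denominator equal to [b / 4]. The numerator decays at rate
   [b - b / 4], which leaves [b / 2] for the quotient. *)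
pose eta := b / 32.
have eta0 : 0 < eta by rewrite divr_gt0.
pose e := eta * (1 - expR (- eta)).
have e0 : 0 < e by rewrite mulr_gt0// subr_gt0 expR_lt1 oppr_lt0.
pose F n w := \prod_(i < n) f0 (X i w).
pose l n w := expR (- (8 * eta * n%:R)) * F n w.
have ml n : measurable_fun setT (l n).
  apply: measurable_funM => //; apply: measurable_prod => i _.
  exact: measurableT_comp.
have l0 n w : 0 <= l n w by rewrite mulr_ge0 ?expR_ge0 ?prodr_ge0.
have den := ae_marginal_lik_ge mX pi2 f2 mf2 f2_ge0 l _ ml l0
  (measurable_dK_lt df0 iid f2 e%:E df2 mf2) (KLsupp e e0)
  (fun th => ae_prod_ge df0 iid (f2 th) eta (df2 th) eta0).
have num := ae_root_lik_lt df0 iid pi1 f1 df1 mf1 b delta d0 erefl dH_ge.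
(* Condition (ii) is used at [b / 2], so that the root of the likelihood ratio grows at rate at most
   [b / 4]. *)
have b2 : 0 < b / 2 by rewrite divr_gt0.
have sup := supL (b / 2) b2.
have pos : {ae P, forall w, forall i, 0 < f0 (X i w)}.
  by apply: (ae_comp_gt0 df0 iid) => //; exact: aeW.
apply: filterS3 den (filterI num sup) pos.
move=> w [c c0 [N2 H2]] [[N1 H1] [N3 H3]] f0w.
have F0 n : 0 < F n w by exact: prodr_gt0.
have B n : (N1 <= n)%N -> (N2 <= n)%N -> (N3 <= n)%N ->
    0 <= bayes_factor pi1 f1 pi2 f2 X n w <= c^-1 * expR (- (b / 2)) ^+ n.
  move=> /H1 Hn1 /H2 Hn2 /H3 Hn3.
  pose s th := \prod_(i < n) Num.sqrt (f1 th (X i w) / f0 (X i w)).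
  have s0 th : 0 <= s th by apply: prodr_ge0 => i _; exact: sqrtr_ge0.
  have sE th : \prod_(i < n) f1 th (X i w) = F n w * s th ^+ 2.
    rewrite /F /s -prodrXl -big_split/=; apply: eq_bigr => i _.
    by rewrite sqr_sqrtr ?divr_ge0// mulrC divfK// gt_eqF.
  have sle th : s th <= expR (n%:R * (b / 4)).
    rewrite -ler_sqr ?nnegrE ?expR_ge0// -lee_fin.
    have -> : expR (n%:R * (b / 4)) ^+ 2 = expR (n%:R * (b / 2)).
      by rewrite -expRM_natl; congr expR; field.
    apply/ltW/(le_lt_trans _ Hn3); apply: ereal_sup_ubound; exists th => //.
    congr EFin; rewrite /s -prodrXl; apply: eq_bigr => i _.
    by rewrite sqr_sqrtr ?divr_ge0.
  have ms : measurable_fun setT s.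
    apply: measurable_prod => i _; apply: measurable_fun_sqrt.
    apply: measurable_funM => //.
    exact: (measurableT_comp mf1 (measurable_pair2 (X i w))).
  (* In [s th ^+ 2], one factor is bounded by [sle] and the other is integrated with [Hn1]. *)
  have I1 : (marginal_lik pi1 f1 X n w <=
    (F n w * expR (n%:R * (b / 4)) * expR (- (n%:R * b)))%:E)%E.
    rewrite /marginal_lik; under eq_integral do rewrite sE.
    apply: (@le_trans _ _ (\int[pi1]_th
      ((F n w * expR (n%:R * (b / 4)))%:E * (s th)%:E))%E).
      apply: ge0_le_integral => //.
      - by move=> th _; rewrite lee_fin mulr_ge0 ?sqr_ge0 ?ltW.
      - by apply/measurable_EFinP/measurable_funM => //; exact: measurable_funX.
      - by apply/measurable_EFinP/measurable_funM.
      - move=> th _; rewrite -EFinM lee_fin -mulrA ler_pM2l// expr2.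
        by rewrite ler_wpM2r.
    rewrite ge0_integralZl//; last 3 first.
    - exact/measurable_EFinP.
    - by move=> th _; rewrite lee_fin.
    - by rewrite lee_fin mulr_ge0 ?expR_ge0 ?ltW.
    rewrite [leRHS]EFinM lee_wpmul2l//; first by rewrite lee_fin mulr_ge0 ?expR_ge0 ?ltW.
    rewrite -(@lee_pmul2l _ (expR (n%:R * b))%:E) ?lte_fin ?expR_gt0// -EFinM -expRD subrr expR0.
    exact: ltW.
  have M1_0 : (0 <= marginal_lik pi1 f1 X n w)%E.
    by apply: integral_ge0 => th _; rewrite lee_fin prodr_ge0.
  have M1fin : marginal_lik pi1 f1 X n w \is a fin_num.
    by rewrite ge0_fin_numE// (le_lt_trans I1)// ltry.
  have M2_0 : (0 <= marginal_lik pi2 f2 X n w)%E.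
    by apply: integral_ge0 => th _; rewrite lee_fin prodr_ge0.
  rewrite /bayes_factor divr_ge0 ?fine_ge0//=.
  have bd0 : 0 <= c^-1 * expR (- (b / 2)) ^+ n.
    by rewrite mulr_ge0 ?invr_ge0 ?exprn_ge0 ?expR_ge0// ltW.
  (* An infinite denominator has [fine] equal to [0], and division by [0] makes the quotient [0]. *)
  have [M2y|M2fin] := eqVneq (marginal_lik pi2 f2 X n w) +oo%E.
    by rewrite M2y/= invr0 mulr0.
  have {}M2fin : marginal_lik pi2 f2 X n w \is a fin_num.
    by rewrite ge0_fin_numE// ltey.
  have cl0 : 0 < c * l n w by rewrite !mulr_gt0 ?expR_gt0.
  have Hn2' : c * l n w <= fine (marginal_lik pi2 f2 X n w).
    by rewrite -lee_fin fineK.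
  rewrite ler_pdivrMr; last exact: lt_le_trans Hn2'.
  apply: (@le_trans _ _ (c^-1 * expR (- (b / 2)) ^+ n * (c * l n w))); last first.
    by rewrite ler_wpM2l.
  rewrite -lee_fin fineK//; apply: (le_trans I1); rewrite lee_fin.
  have -> : c^-1 * expR (- (b / 2)) ^+ n * (c * l n w) =
    F n w * (expR (- (b / 2)) ^+ n * expR (- (8 * eta * n%:R))).
    by rewrite /l; field; rewrite gt_eqF.
  rewrite -expRM_natl -mulrA -!expRD ler_pM2l// ler_expR /eta le_eqVlt.
  by apply/orP; left; apply/eqP; field.
apply: (@squeeze_cvgr _ _ _ _ (cst 0) (fun n => c^-1 * expR (- (b / 2)) ^+ n)).
- near=> n; apply: B; near: n; exact: nbhs_infty_ge.
- exact: cvg_cst.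
- rewrite -[X in _ --> X](mulr0 c^-1); apply: cvgMr.
  by apply: cvg_expr; rewrite ger0_norm ?expR_ge0// expR_lt1 oppr_lt0.
Unshelve. all: by end_near. Qed.
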